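(* Let $P$ be a set of $n$ points in the plane in general position (no three collinear) and let $x\in P$. Then $$\Delta(x,P)\le V_P(x)+H\bigl(V_P(x),K_3,K_4\setminus\{e\}\bigr).$$ Moreover, there exists a constant $C>0$ (independent of $n$) such that for every positive integer $n$ there exist a set $P$ of $n$ points in the plane in general position and a point $x\in P$ with $\Delta(x,P)\ge C\,V_P(x)^{3/2}$.
   Context: For a finite point set $Q$ in the plane in general position, an empty triangle of $Q$ is a triangle with vertices in $Q$ whose interior contains no point of $Q$; $N_\triangle(Q)$ denotes the number of empty triangles of $Q$. For $x\in P$, $\Delta(x,P)=|N_\triangle(P)-N_\triangle(P\setminus\{x\})|$, and $V_P(x)$ is the number of empty triangles of $P$ having $x$ as a vertex. The kite graph $K_4\setminus\{e\}$ is the complete graph $K_4$ with one edge removed. For a positive integer $m$, $H(m,K_3,K_4\setminus\{e\})$ denotes the maximum number of triangles in a graph on $m$ vertices that contains no subgraph isomorphic to $K_4\setminus\{e\}$. *)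

(* Defs.v *)
From HB Require Import structures.
From mathcomp Require Import all_boot all_order all_algebra.
From mathcomp Require Import finmap.
From mathcomp Require Import all_classical all_reals all_analysis.
Export numFieldNormedType.Exports.

Set Implicit Arguments.
Unset Strict Implicit.
Unset Printing Implicit Defensive.

Import Order.TTheory GRing.Theory Num.Theory.

Local Open Scope set_scope.
Local Open Scope ring_scope.

Definition collinear3 (R : realType) (p q r : R * R) : Prop :=
  exists a b c : R, (a, b) <> (0, 0) /\
    forall s : R * R, s = p \/ s = q \/ s = r -> a * s.1 + b * s.2 = c.

Definition general_position (R : realType) (P : {fset R * R}) : Prop :=
  forall p q r : R * R, p \in P -> q \in P -> r \in P ->
    p <> q -> q <> r -> p <> r -> ~ collinear3 p q r.

Definition convex_hull (R : realType) (T : {fset R * R}) : set (R * R) :=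
  [set p : R * R | exists w : R * R -> R,
    [/\ forall q, q \in T -> 0 <= w q,
        \sum_(q <- T) w q = 1 &
        \sum_(q <- T) w q *: q = p]]%classic.

(* A triangle is represented by its set T of three vertices, and its interior
   is the topological interior of the convex hull of T. *)
Definition is_empty_triangle (R : realType) (Q T : {fset R * R}) : Prop :=
  [/\ (T `<=` Q)%fset, #|` T|%fset = 3%N &
      forall p, p \in Q -> ~ (interior (convex_hull T)) p].

Definition empty_triangles (R : realType) (Q : {fset R * R}) :
    {fset {fset R * R}} :=
  [fset T in fpowerset Q | `[< is_empty_triangle Q T >]]%fset.

Definition num_empty_triangles (R : realType) (Q : {fset R * R}) : nat :=
  #|` empty_triangles Q|%fset.

(* The absolute difference is taken in int, not with truncated subtraction. *)
Definition Delta (R : realType) (x : R * R) (P : {fset R * R}) : nat :=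
  `|(num_empty_triangles P)%:Z - (num_empty_triangles (P `\ x)%fset)%:Z|%N.

Definition num_empty_triangles_at (R : realType) (P : {fset R * R})
    (x : R * R) : nat :=
  #|` [fset T in empty_triangles P | x \in (T : {fset R * R})]|%fset.

(* A simple graph on a finite type of vertices is given by its set of edges,
   an edge being a set of two vertices. *)
Definition simple_graph (V : finType) (E : {set {set V}}) : bool :=
  [forall A in E, #|A| == 2%N].

Definition complete_graph (V : finType) : {set {set V}} :=
  [set A : {set V} | #|A| == 2%N].

Definition kite : {set {set 'I_4}} :=
  complete_graph 'I_4 :\ [set inord 0; inord 1].

(* Subgraphs need not be induced. *)
Definition has_copy (V W : finType) (E : {set {set V}}) (F : {set {set W}}) :
    bool :=
  [exists f : {ffun W -> V}, injectiveb f && [forall A in F, f @: A \in E]].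

Definition num_triangles (V : finType) (E : {set {set V}}) : nat :=
  #|[set T : {set V} | (#|T| == 3%N) &&
      [forall A : {set V}, (A \subset T) && (#|A| == 2%N) ==> (A \in E)]]|.

(* For m = 0 this is 0. *)
Definition H_K3_kite (m : nat) : nat :=
  \max_(E : {set {set 'I_m}} | simple_graph E && ~~ has_copy E kite)
    num_triangles E.

(* Main.v *)
(** Write [V] for the empty triangles of [P] at [x], and [B] for the triangles of
    [P \ x] whose only interior point in [P] is [x].  The empty triangles of [P]
    avoiding [x] are counted on both sides, so Delta = | |V| - |B| |.

    Upper bound: if [abc] is in [B], then [xab], [xbc] and [xac] are in [V].
    Join two members of [V] when they arise from a common member of [B]; each
    member of [B] gives a triangle of this graph.  The graph has no kite: the
    adjacent vertices [xab] and [xbc] have [xac] as their only common neighbor,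
    since a second one would be some [xbd] with [x] interior to [abc], [abd] and
    [bcd], and then [a], [c], [d] would lie pairwise on opposite sides of the
    line [xb].

    Lower bound: let [m = n - 1] points lie on a parabola, so that they are in
    convex position and every triangle they span is empty, and put [x] inside.
    Then [|V| <= m ^ 2].  With three clusters of [k = m %/ 3] points such that
    [x] is interior to each triangle with one vertex in each cluster,
    [|B| >= k ^ 3].  For small [m], putting [x] outside the convex hull gives
    Delta = |V|. *)

Require Import Defs.
From mathcomp Require Import all_boot all_order all_algebra.
From mathcomp Require Import finmap.
From mathcomp Require Import all_classical all_reals all_analysis.
From mathcomp Require Import ring lra zify.
Import Order.TTheory GRing.Theory Num.Theory.
Set Implicit Arguments.
Unset Strict Implicit.
Unset Printing Implicit Defensive.
Local Open Scope classical_set_scope.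
Local Open Scope set_scope.
Local Open Scope fset_scope.
Local Open Scope ring_scope.

(** * Convex hulls and orientation *)

(** Otherwise the linear form with coefficients [u], [v] would be bounded on the whole hull by its
    value at [p], yet a small step from [p] in direction [(u, v)] stays in the hull and increases
    the form. *)
Lemma interior_hull_gt (R : realType) (T : {fset R * R}) (p : R * R) (u v : R) :
  interior (convex_hull T) p -> (u, v) <> (0, 0) ->
  exists2 q, q \in T & u * p.1 + v * p.2 < u * q.1 + v * q.2.
Proof.
move=> pT uv0; apply: contrapT => noq.
have Tle q : q \in T -> u * q.1 + v * q.2 <= u * p.1 + v * p.2.
  by move=> qT; rewrite leNgt; apply/negP => lt_pq; apply: noq; exists q.
have hull_le y : convex_hull T y -> u * y.1 + v * y.2 <= u * p.1 + v * p.2.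
  case=> w [w_ge0 w_sum <-].
  have -> : u * (\sum_(q <- T) w q *: q).1 + v * (\sum_(q <- T) w q *: q).2 =
            \sum_(q <- T) w q * (u * q.1 + v * q.2).
    rewrite (raddf_sum fst) (raddf_sum snd) /= !mulr_sumr -big_split /=.
    by apply: eq_bigr => q _; rewrite mulrDr mulrCA (mulrCA v).
  rewrite -[leRHS]mul1r -w_sum mulr_suml big_seq [leRHS]big_seq.
  by apply: ler_sum => q qT; rewrite ler_wpM2l ?w_ge0 ?Tle.
have cvg_line : p + e *: (u, v) @[e --> (0 : R)^'+] --> p.
  rewrite -[X in _ --> X]addr0 -(scale0r (u, v)).
  apply: cvg_at_right_filter; apply: cvgD; first exact: cvg_cst.
  by apply: cvgZr_tmp; exact: cvg_id.
have [e [e_gt0 /hull_le]] := filter_ex (filterI (nbhs_right_gt 0) (cvg_line _ pT)).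
rewrite /= -[e *: u]/(e * u) -[e *: v]/(e * v) => le_p; apply: uv0.
have : e * (u ^+ 2 + v ^+ 2) <= 0 by nra.
rewrite pmulr_rle0 // => uv_le0; congr (_, _); nra.
Qed.

(** The weight that a combination over [S] gives to [x] is redistributed over [T] along a convex
    combination equal to [x]. *)
Lemma convex_hull_subU1 (R : realType) (S T : {fset R * R}) (x : R * R) :
  S `<=` x |` T -> x \notin T -> convex_hull T x ->
  (convex_hull S `<=` convex_hull T)%classic.
Proof.
move=> ST xT [v [v_ge0 v_sum v_x]] p [w [w_ge0 w_sum w_p]].
(* The weights [w] are controlled on [S] only, so they are cut off outside it; in particular [w1 x]
   is 0 when [x] is not in [S]. *)
pose w1 q := if q \in S then w q else 0.
have w1_ge0 q : 0 <= w1 q by rewrite /w1; case: ifP => // /w_ge0.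
have w1S q : q \in S -> w1 q = w q by rewrite /w1 => ->.
have extS (W : nmodType) (F : R -> R * R -> W) : (forall q, F 0 q = 0) ->
    \sum_(q <- S) F (w q) q = F (w1 x) x + \sum_(q <- T) F (w1 q) q.
  move=> F0; rewrite -(big_fsetU1 _ (fun q => F (w1 q) q) xT) /=.
  under eq_big_seq => q qS do rewrite -w1S //.
  by apply: big_fset_incl => // q _ qS; rewrite /w1 (negPf qS) F0.
exists (fun q => w1 q + w1 x * v q); split.
- by move=> q qT; rewrite addr_ge0 ?mulr_ge0 ?v_ge0.
- rewrite big_split /= -mulr_sumr v_sum addrC.
  by rewrite mulr1 -w_sum (extS _ (fun c _ => c)).
- under eq_bigr do rewrite scalerDl -scalerA.
  rewrite big_split /= -scaler_sumr v_x addrC -w_p.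
  by rewrite (extS _ (fun c q => c *: q)) // => q; rewrite scale0r.
Qed.

(** Twice the signed area of [pqr], positive when the triangle is counterclockwise. *)
Definition orient (R : realType) (p q r : R * R) : R :=
  (q.1 - p.1) * (r.2 - p.2) - (q.2 - p.2) * (r.1 - p.1).

Lemma collinear3_orient (R : realType) (p q r : R * R) :
  collinear3 p q r -> orient p q r = 0.
Proof.
case=> a [b [c [ab0 on_line]]].
have ep := on_line p (or_introl erefl).
have eq := on_line q (or_intror (or_introl erefl)).
have er := on_line r (or_intror (or_intror erefl)).
have a0 : a * orient p q r = 0.
  transitivity ((a * q.1 + b * q.2 - (a * p.1 + b * p.2)) * (r.2 - p.2) -
      (a * r.1 + b * r.2 - (a * p.1 + b * p.2)) * (q.2 - p.2)).
    by rewrite /orient; ring.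
  by rewrite ep eq er subrr !mul0r subrr.
have b0 : b * orient p q r = 0.
  transitivity ((a * r.1 + b * r.2 - (a * p.1 + b * p.2)) * (q.1 - p.1) -
      (a * q.1 + b * q.2 - (a * p.1 + b * p.2)) * (r.1 - p.1)).
    by rewrite /orient; ring.
  by rewrite ep eq er subrr !mul0r subrr.
apply: contra_notP ab0 => /eqP/negPf o0; congr (_, _); apply/eqP.
- by move/eqP: a0; rewrite mulf_eq0 o0 orbF.
- by move/eqP: b0; rewrite mulf_eq0 o0 orbF.
Qed.

(** Divided by [orient a b c], the three orientations are the barycentric coordinates of [x]; by
    continuity they remain positive near [x]. *)
Lemma orient_interior (R : realType) (a b c x : R * R) :
  0 < orient x b c -> 0 < orient a x c -> 0 < orient a b x ->
  interior (convex_hull [fset a; b; c]) x.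
Proof.
move=> oa ob oc.
have D_gt0 : 0 < orient a b c.
  have -> : orient a b c = orient x b c + orient a x c + orient a b x.
    by rewrite /orient; ring.
  by apply: addr_gt0 => //; apply: addr_gt0.
have neq_ab : a != b.
  by apply: contraTneq D_gt0 => ->; rewrite /orient -leNgt; lra.
have neq_ac : a != c.
  by apply: contraTneq D_gt0 => ->; rewrite /orient -leNgt; lra.
have neq_bc : b != c.
  by apply: contraTneq D_gt0 => ->; rewrite /orient -leNgt; lra.
have sub p : 0 < orient p b c -> 0 < orient a p c -> 0 < orient a b p ->
    convex_hull [fset a; b; c] p.
  move=> pa pb pc.
  pose w q := (if q == a then orient p b c else if q == b then orient a p c
               else orient a b p) / orient a b c.
  have wa : w a = orient p b c / orient a b c by rewrite /w eqxx.
  have wb : w b = orient a p c / orient a b c.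
    by rewrite /w eq_sym (negPf neq_ab) eqxx.
  have wc : w c = orient a b p / orient a b c.
    by rewrite /w ![c == _]eq_sym (negPf neq_ac) (negPf neq_bc).
  have D0 : orient a b c != 0 by rewrite gt_eqF.
  have sum3 (W : nmodType) (F : R * R -> W) :
      \sum_(q <- [fset a; b; c]) F q = F a + F b + F c.
    rewrite -fsetUA big_fsetU1 ?inE ?negb_or ?neq_ab //=.
    by rewrite big_fsetU1 ?inE //= big_seq_fset1 addrA.
  exists w; split.
  - move=> q _; rewrite /w divr_ge0 1?ltW //; by do 2?case: ifP.
  - rewrite sum3 wa wb wc -!mulrDl; apply/eqP; rewrite -(inj_eq (mulIf D0)).
    by rewrite divfK // mul1r /orient; apply/eqP; ring.
  - rewrite sum3 wa wb wc [RHS]surjective_pairing [LHS]surjective_pairing.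
    by rewrite /= /GRing.scale /= /orient in D0 *; congr (_, _); field.
have cvg1 : q.1 @[q --> x] --> x.1 by exact: cvg_fst.
have cvg2 : q.2 @[q --> x] --> x.2 by exact: cvg_snd.
have near_gt0 (f : R * R -> R) : f q @[q --> x] --> f x -> 0 < f x ->
    \forall q \near x, 0 < f q.
  by move=> fx f0; exact: cvgr_gt fx _ f0.
rewrite /interior /=.
have : \forall p \near x, 0 < orient p b c.
  apply: near_gt0 => //; rewrite /orient.
  by apply: cvgB; apply: cvgM; apply: cvgB => //; exact: cvg_cst.
have : \forall p \near x, 0 < orient a p c.
  apply: near_gt0 => //; rewrite /orient.
  by apply: cvgB; apply: cvgM => //; try apply: cvgB => //; exact: cvg_cst.
have : \forall p \near x, 0 < orient a b p.
  apply: near_gt0 => //; rewrite /orient.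
  by apply: cvgB; apply: cvgM => //; try apply: cvgB => //; exact: cvg_cst.
by apply: filterS3 => p ? ? ?; exact: sub.
Qed.

(** As a function of [p], [s * orient x b p] is a nonzero linear form minus its value at [x]. The
    sign of [s] selects a side of the line [xb]. *)
Lemma interior_hull_side (R : realType) (T : {fset R * R}) (x b : R * R) (s : R) :
  interior (convex_hull T) x -> b != x -> s != 0 ->
  exists2 p, p \in T & 0 < s * orient x b p.
Proof.
move=> xT bx s0; have [|p pT lt_xp] :=
    @interior_hull_gt _ T x (- s * (b.2 - x.2)) (s * (b.1 - x.1)) xT.
  move=> [] /eqP; rewrite mulNr oppr_eq0 mulf_eq0 (negPf s0) /= => /eqP b2.
  move=> /eqP; rewrite mulf_eq0 (negPf s0) /= => /eqP b1.
  move/eqP: bx; apply; rewrite [b]surjective_pairing [x]surjective_pairing.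
  by congr (_, _); lra.
by exists p => //; rewrite /orient; nra.
Qed.

(** The triangle has vertices strictly on both sides of the line [xb], and [b] lies on it. *)
Lemma orient_vertices_opposite (R : realType) (x a b c : R * R) :
  interior (convex_hull [fset a; b; c]) x -> b != x ->
  orient x b a * orient x b c < 0.
Proof.
move=> xT bx.
have obb : orient x b b = 0 by rewrite /orient mulrC subrr.
have [p pT p_gt0] := interior_hull_side xT bx (oner_neq0 R).
have N1 : -1 != 0 :> R by rewrite oppr_eq0 oner_eq0.
have [q qT q_lt0] := interior_hull_side xT bx N1.
move: pT qT p_gt0 q_lt0; rewrite !inE -!orbA.
by move=> /or3P[]/eqP-> /or3P[]/eqP->; rewrite ?obb; nra.
Qed.

(** If [x] were interior, then [a] and [x] would lie strictly on opposite sides of the line [xb],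
    which contains [x]. *)
Lemma vertex_notin_interior (R : realType) (x a b : R * R) :
  b != x -> ~ interior (convex_hull [fset x; a; b]) x.
Proof.
move=> bx; have -> : [fset x; a; b] = [fset a; b; x].
  by apply/fsetP => q; rewrite !inE; case: eqP; case: eqP; case: eqP.
move=> /orient_vertices_opposite /(_ bx).
by rewrite {2}/orient !subrr !mulr0 subrr mulr0 ltxx.
Qed.

(** * Sets of two and three elements *)

Lemma cardfs2P (K : choiceType) (A : {fset K}) : #|` A| = 2%N ->
  exists a b, a != b /\ A = [fset a; b].
Proof.
move=> A2; have /fset0Pn[a aA] : A != fset0 by rewrite -cardfs_gt0 A2.
have : #|` A `\ a| == 1%N by move: A2; rewrite (cardfsD1 a) aA add1n => -[->].
move=> /cardfs1P[b Ab]; exists a, b; rewrite -Ab fsetD1K //; split=> //.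
have: b \in A `\ a by rewrite Ab !inE.
by rewrite !inE eq_sym => /andP[].
Qed.

Lemma cardfs3P (K : choiceType) (A : {fset K}) (x : K) : #|` A| = 3%N -> x \in A ->
  exists a b, [/\ a != x, b != x, a != b & A = [fset x; a; b]].
Proof.
move=> A3 xA; have : #|` A `\ x| = 2%N.
  by move: A3; rewrite (cardfsD1 x) xA add1n => -[->].
move=> /cardfs2P[a [b [ab Ab]]]; exists a, b.
have aA : a \in A `\ x by rewrite Ab !inE eqxx.
have bA : b \in A `\ x by rewrite Ab !inE eqxx orbT.
by move: aA bA; rewrite !inE -fsetUA -Ab fsetD1K // => /andP[-> _] /andP[-> _].
Qed.

Lemma cardfs3 (K : choiceType) (a b c : K) :
  a != b -> a != c -> b != c -> #|` [fset a; b; c]| = 3%N.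
Proof.
by move=> ab ac bc; rewrite -fsetUA cardfsU1 cardfs2 !inE negb_or ab ac bc.
Qed.

Lemma fsubset_card_eq (K : choiceType) (A B : {fset K}) :
  A `<=` B -> #|` A| = #|` B| -> A = B.
Proof. by move=> AB eqAB; apply/eqP; rewrite eqEfcard AB eqAB leqnn. Qed.

(** * Triangles around a point and their faces *)

Definition stabbed (R : realType) (x : R * R) (T : {fset R * R}) : Prop :=
  [/\ #|` T| = 3%N, x \notin T & interior (convex_hull T) x].

Lemma stabbed_opposite (R : realType) (x a b c : R * R) (T : {fset R * R}) :
  stabbed x T -> a \in T -> b \in T -> c \in T -> a != b -> b != c -> a != c ->
  orient x b a * orient x b c < 0.
Proof.
case=> T3 xT Tx aT bT cT ab bc ac; apply: orient_vertices_opposite.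
  suff -> : [fset a; b; c] = T by [].
  apply: fsubset_card_eq; first by rewrite !fsubUset !fsub1set aT bT.
  by rewrite T3 cardfs3.
by apply: contraNneq xT => <-.
Qed.

(** For three-element sets [S] and [S'] containing [x], the inclusions say that each consists of [x]
    and two vertices of [T]. *)
Definition adjacent_faces (R : realType) (x : R * R) (S S' T : {fset R * R}) : Prop :=
  [/\ stabbed x T, S `<=` x |` T & S' `<=` x |` T].

Lemma stabbed_card4 (R : realType) (x : R * R) (T : {fset R * R}) :
  stabbed x T -> #|` x |` T| = 4%N.
Proof. by case=> T3 xT _; rewrite cardfsU1 xT T3. Qed.

Lemma stabbed_face (R : realType) (x b : R * R) (S T : {fset R * R}) :
  stabbed x T -> #|` S| = 3%N -> S `<=` x |` T ->
  b \in x |` T -> b \notin S -> S = (x |` T) `\ b.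
Proof.
move=> sT S3 ST bT bS; apply: fsubset_card_eq.
  by rewrite fsubsetD1 ST.
by have := stabbed_card4 sT; rewrite (cardfsD1 b) bT S3 add1n => -[].
Qed.

(** This excludes kites: [b], the vertex shared by [S] and [S'] besides [x], is chosen before [S0],
    so any two common neighbors are the same face. The triangles [U] and [U'] witnessing the
    adjacencies may differ from [T]. *)
Lemma common_neighbor (R : realType) (x : R * R) (S S' T : {fset R * R}) :
  x \in S -> x \in S' -> #|` S| = 3%N -> #|` S'| = 3%N -> S != S' ->
  adjacent_faces x S S' T ->
  exists2 b, b \in T & forall S0 U U' : {fset R * R},
    x \in S0 -> #|` S0| = 3%N -> S0 != S -> S0 != S' ->
    adjacent_faces x S0 S U -> adjacent_faces x S0 S' U' -> S0 = (x |` T) `\ b.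
Proof.
move=> xS xS' S3 S'3 neqSS' [sT ST S'T].
have faceP (S1 : {fset R * R}) : x \in S1 -> #|` S1| = 3%N -> S1 `<=` x |` T ->
    exists2 c, c \in T & S1 = (x |` T) `\ c.
  move=> xS1 S13 S1T; have : #|` (x |` T) `\` S1| == 1%N.
    by rewrite cardfsDS // stabbed_card4 // S13.
  move=> /cardfs1P[c cE]; have : c \in (x |` T) `\` S1 by rewrite cE !inE.
  rewrite !inE => /andP[cS1 /orP[/eqP cx|cT]]; first by rewrite cx xS1 in cS1.
  by exists c => //; apply: stabbed_face => //; rewrite !inE cT orbT.
have [c cT Sc] := faceP _ xS S3 ST; have [a aT S'a] := faceP _ xS' S'3 S'T.
have ac : a != c by apply: contraNneq neqSS' => eq_ac; rewrite Sc S'a eq_ac.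
have [T3 xT _] := sT.
have : #|` T `\ a `\ c| == 1%N.
  move: T3; rewrite (cardfsD1 a) aT (cardfsD1 c) !inE eq_sym ac cT => /eqP.
  by rewrite !add1n !eqSS.
move=> /cardfs1P[b bE]; have : b \in T `\ a `\ c by rewrite bE !inE.
rewrite !inE => /and3P[bc ba bT].
have neqx q : q \in T -> q != x by move=> qT; apply: contraNneq xT => <-.
have inS q : q \in T -> q != c -> q \in S by move=> qT qc; rewrite Sc !inE qc qT orbT.
have inS' q : q \in T -> q != a -> q \in S'.
  by move=> qT qa; rewrite S'a !inE qa qT orbT.
exists b => // S0 U U' xS0 S03 neqS neqS' [sU S0U SU] [sU' S0U' S'U'].
have inU q : q \in T -> q \in x |` U -> q \in U.
  by move=> qT; rewrite !inE (negPf (neqx q qT)).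
have inU' q : q \in T -> q \in x |` U' -> q \in U'.
  by move=> qT; rewrite !inE (negPf (neqx q qT)).
have aU : a \in U by apply/inU/(fsubsetP SU)/inS.
have bU : b \in U by apply/inU/(fsubsetP SU)/inS.
have bU' : b \in U' by apply/inU'/(fsubsetP S'U')/inS'.
have cU' : c \in U' by apply/inU'/(fsubsetP S'U')/inS'; rewrite // eq_sym.
(* If [b] is not in [S0], then [S0] is what remains of both [x |] U[and]x |[U'] without [b]; the
   first contains [a] and the second [c], so [S0] is [xac]. *)
have [bS0|bS0] := boolP (b \in S0); last first.
  have S0Ub : S0 = (x |` U) `\ b.
    by apply: stabbed_face => //; rewrite !inE bU orbT.
  have S0U'b : S0 = (x |` U') `\ b.
    by apply: stabbed_face => //; rewrite !inE bU' orbT.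
  apply: stabbed_face => //; last by rewrite !inE bT orbT.
  have -> : S0 = [fset x; a; c].
    apply/esym/fsubset_card_eq; last first.
      by rewrite S03 cardfs3 // eq_sym neqx.
    rewrite !fsubUset !fsub1set xS0 {1}S0Ub S0U'b !inE aU cU' !orbT.
    by rewrite !(eq_sym _ b) ba bc.
  by rewrite !fsubUset !fsub1set !inE eqxx aT cT !orbT.
(* [a], [c], [d] cannot lie pairwise on opposite sides of the line [x b]. *)
have bx := neqx _ bT.
have [d [dx db S0E]] : exists d, [/\ d != x, d != b & S0 = [fset x; b; d]].
  have [p [q [px qx pq S0E]]] := cardfs3P S03 xS0.
  move: bS0; rewrite S0E !inE (negPf bx) /= => /orP[] /eqP eqb.
    by exists q; rewrite eqb (eq_sym q p) pq.
  by exists p; rewrite eqb pq; split=> //; rewrite -!fsetUA (fsetUC [fset p]).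
have tri q : q \in T -> q != b -> #|` [fset x; b; q]| = 3%N.
  by move=> qT qb; rewrite cardfs3 1?eq_sym // neqx.
(* The vertex [d] is new: [d = a] would make [S0] equal to [S], and [d = c] would make it equal to
   [S']. *)
have da : d != a.
  apply: contraNneq neqS => dE; rewrite S0E dE; apply/eqP.
  apply: fsubset_card_eq; last by rewrite tri // eq_sym.
  by rewrite !fsubUset !fsub1set xS !inS.
have dc : d != c.
  apply: contraNneq neqS' => dE; rewrite S0E dE; apply/eqP.
  apply: fsubset_card_eq; last by rewrite tri // eq_sym.
  by rewrite !fsubUset !fsub1set xS' !inS' // eq_sym.
have dS0 : d \in S0 by rewrite S0E !inE eqxx orbT.
have dU : d \in U by have /(fsubsetP S0U) := dS0; rewrite !inE (negPf dx).
have dU' : d \in U' by have /(fsubsetP S0U') := dS0; rewrite !inE (negPf dx).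
have ab : a != b by rewrite eq_sym.
have bd : b != d by rewrite eq_sym.
have ad : a != d by rewrite eq_sym.
have cb : c != b by rewrite eq_sym.
have cd : c != d by rewrite eq_sym.
have := stabbed_opposite sT aT bT cT ab bc ac.
have := stabbed_opposite sU aU bU dU ab bd ad.
have := stabbed_opposite sU' cU' bU' dU' cb bd cd.
move: (orient x b a) (orient x b c) (orient x b d) => oa oc od.
(* Three reals cannot have pairwise negative products: two of the products multiply to a square
   times the third. *)
move=> cd_lt0 ad_lt0 ac_lt0; have : 0 < (oc * od) * (oa * oc) by rewrite nmulr_rgt0.
have -> : (oc * od) * (oa * oc) = oc ^+ 2 * (oa * od) by ring.
by rewrite ltNge mulr_ge0_le0 ?sqr_ge0 // ltW.
Qed.

(** * The upper bound *)

Lemma in_fset_sep (K : choiceType) (A : {fset K}) (p : pred K) (a : K) :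
  (a \in [fset b in A | p b]) = (a \in A) && p a.
Proof. by rewrite !inE. Qed.

(** The set [B] of the overview. *)
Definition empty_but (R : realType) (x : R * R) (P : {fset R * R}) :
    {fset {fset R * R}} :=
  [fset T in empty_triangles (P `\ x) | `[< interior (convex_hull T) x >]].

Lemma empty_trianglesP (R : realType) (Q T : {fset R * R}) :
  reflect (is_empty_triangle Q T) (T \in empty_triangles Q).
Proof.
rewrite /empty_triangles !inE /= fpowersetE.
apply: (iffP andP) => [[_ /asboolP //]|QT].
by case: (QT) => TQ _ _; split => //; exact/asboolP.
Qed.

Lemma empty_but_stabbed (R : realType) (x : R * R) (P T : {fset R * R}) :
  T \in empty_but x P -> stabbed x T.
Proof.
rewrite in_fset_sep => /andP[/empty_trianglesP[TP T3 _] /asboolP Tx]; split=> //.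
by move: TP; rewrite fsubsetD1 => /andP[].
Qed.

(** Here [k] counts the empty triangles of [P] avoiding [x]. It cancels in [Delta], so its value is
    left unspecified. *)
Lemma card_empty_triangles (R : realType) (x : R * R) (P : {fset R * R}) :
  x \in P ->
  exists k : nat, num_empty_triangles P = (num_empty_triangles_at P x + k)%N /\
    num_empty_triangles (P `\ x) = (#|` empty_but x P| + k)%N.
Proof.
move=> xP; set A := [fset T in empty_triangles P | x \notin (T : {fset R * R})].
have inA (T : {fset R * R}) : (T \in A) = (T \in empty_triangles P) && (x \notin T).
  by rewrite in_fset_sep.
exists #|` A|; rewrite /num_empty_triangles /num_empty_triangles_at; split.
- set V := [fset T in _ | _].
  have inV (T : {fset R * R}) : (T \in V) = (T \in empty_triangles P) && (x \in T).
    by rewrite in_fset_sep.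
  have -> : empty_triangles P = V `|` A.
    by apply/fsetP => T; rewrite in_fsetU inV inA -andb_orr orbN andbT.
  rewrite cardfsU (_ : V `&` A = fset0) ?cardfs0 ?subn0 //.
  apply/fsetP => T; rewrite in_fsetI inV inA in_fset0.
  by case: (x \in T); rewrite ?andbF.
- have inB (T : {fset R * R}) : (T \in empty_but x P) =
      (T \in empty_triangles (P `\ x)) && `[< interior (convex_hull T) x >].
    by rewrite in_fset_sep.
  have -> : empty_triangles (P `\ x) = empty_but x P `|` A.
    apply/fsetP => T; rewrite in_fsetU inB inA.
    apply/idP/idP => [TPx|/orP[/andP[]//|/andP[/empty_trianglesP[TP T3 Te] xT]]].
      rewrite TPx /=; case: asboolP => //= Tx; case/empty_trianglesP: TPx => TP T3 Te.
      move: TP; rewrite fsubsetD1 => /andP[TP xT]; rewrite xT andbT.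
      apply/empty_trianglesP; split=> // p pP; have [->//|px] := eqVneq p x.
      by apply: Te; rewrite !inE px.
    apply/empty_trianglesP; split=> //; first by rewrite fsubsetD1 TP.
    by move=> p; rewrite !inE => /andP[_ /Te].
  rewrite cardfsU (_ : _ `&` A = fset0) ?cardfs0 ?subn0 //.
  apply/fsetP => T; rewrite in_fsetI inB inA in_fset0; apply/negP.
  move=> /andP[/andP[_ /asboolP Tx] /andP[/empty_trianglesP[_ _ Te] _]].
  exact: Te xP Tx.
Qed.

(** The face lies in the hull of [T], so its interior can contain no point of [P] other than [x],
    and [x] is one of its vertices. *)
Lemma face_empty_triangle (R : realType) (x c : R * R) (P T : {fset R * R}) :
  x \in P -> T \in empty_but x P -> c \in T ->
  (x |` T) `\ c \in [fset S in empty_triangles P | x \in (S : {fset R * R})].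
Proof.
move=> xP TB cT; have sT := empty_but_stabbed TB.
have [T3 xT Tx] := sT; move: TB; rewrite in_fset_sep
  => /andP[/empty_trianglesP[TP _ Te] _].
have xc : x != c by apply: contraNneq xT => ->.
rewrite in_fset_sep; set S := _ `\ c.
have xS : x \in S by rewrite !inE xc eqxx.
have ST : S `<=` x |` T by exact: fsubD1set.
have S3 : #|` S| = 3%N.
  have := stabbed_card4 sT; rewrite (cardfsD1 c) !inE cT orbT add1n.
  by move=> [].
rewrite xS andbT; apply/empty_trianglesP; split=> //.
  apply: fsubset_trans ST _; rewrite fsubUset fsub1set xP.
  by apply: fsubset_trans TP _; exact: fsubD1set.
move=> p pP; have [->|px] := eqVneq p x.
  have [a [b [_ bx _ ->]]] := cardfs3P S3 xS; exact: vertex_notin_interior.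
have sub : (convex_hull S `<=` convex_hull T)%classic.
  by apply: convex_hull_subU1 ST xT _; exact: interior_subset.
by move=> /(interiorS sub); apply: Te; rewrite !inE px.
Qed.

Lemma card_empty_but_le (R : realType) (x : R * R) (P : {fset R * R}) :
  x \in P -> (#|` empty_but x P| <= H_K3_kite (num_empty_triangles_at P x))%N.
Proof.
move=> xP; rewrite /num_empty_triangles_at.
set V := [fset S in empty_triangles P | _]; set m := #|` V|.
have inV (S : {fset R * R}) : S \in V -> x \in S /\ #|` S| = 3%N.
  by rewrite in_fset_sep => /andP[/empty_trianglesP[_ S3 _] xS].
(* [H_K3_kite] ranges over graphs on ['I_m], so the members of [V] are numbered. *)
pose lab (i : 'I_m) : {fset R * R} := nth fset0 (enum_fset V) i.
have labV i : lab i \in V by apply: mem_nth; exact: ltn_ord.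
have lab_inj : injective lab.
  move=> i j /eqP; rewrite nth_uniq ?ltn_ord //; last exact: fset_uniq.
  by move=> /eqP /val_inj.
have lab_surj (S : {fset R * R}) : S \in V -> exists i, lab i = S.
  move=> SV; have iV : (index S (enum_fset V) < m)%N by rewrite index_mem.
  by exists (Ordinal iV); rewrite /lab nth_index.
pose E := [set A : {set 'I_m} | (#|A| == 2) &&
  `[< exists2 T : {fset R * R}, T \in empty_but x P &
      forall i, i \in A -> lab i `<=` x |` T >]].
(* The indices of the three faces of [T] at [x]; [tri] will embed [B] into the triangles of the
   graph [E]. *)
pose tri (T : {fset R * R}) := [set i : 'I_m | lab i `<=` x |` T].
have triE (T : {fset R * R}) (A : {set 'I_m}) :
    T \in empty_but x P -> A \subset tri T -> #|A| = 2%N -> A \in E.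
  move=> TB AT A2; rewrite inE A2 eqxx; apply/asboolP; exists T => // i iA.
  by have := fintype.subsetP AT _ iA; rewrite inE.
have edgeE i j : i != j -> [set i; j] \in E ->
    exists T, adjacent_faces x (lab i) (lab j) T.
  move=> ij; rewrite inE => /andP[_ /asboolP[T TB ijT]]; exists T.
  by split; [exact: empty_but_stabbed TB|apply: ijT; rewrite !inE eqxx ?orbT..].
have Ekite : ~~ has_copy E kite.
  apply/negP => /existsP[f /andP[/injectiveP f_inj /forall_inP fE]].
  (* The edge missing from [kite] joins 0 and 1, so a pair is an edge when it meets 2 or 3. Thus 0
     and 1 are common neighbors of the adjacent vertices 2 and 3. *)
  have fadj (u v : nat) : (u < 4)%N -> (v < 4)%N -> u != v -> (2 <= maxn u v)%N ->
      exists T, adjacent_faces x (lab (f (inord u))) (lab (f (inord v))) T.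
    move=> u4 v4 uv uv2.
    have neq_uv : inord u != inord v :> 'I_4 by rewrite -val_eqE /= !inordK.
    apply: edgeE; first by rewrite (inj_eq f_inj).
    have -> : [set f (inord u); f (inord v)] = f @: [set inord u; inord v].
      by rewrite imsetU1 imset_set1.
    apply: fE; rewrite !inE cards2 neq_uv /= andbT.
    apply/eqP => /setP/(_ (inord (maxn u v))); rewrite !inE -!val_eqE /= !inordK //;
      lia.
  have labneq (u v : nat) : (u < 4)%N -> (v < 4)%N -> u != v ->
      lab (f (inord u)) != lab (f (inord v)).
    by move=> u4 v4 uv; rewrite (inj_eq lab_inj) (inj_eq f_inj) -val_eqE /= !inordK.
  have [T T23] := fadj 2%N 3%N isT isT isT isT.
  have [x2 c2] := inV _ (labV (f (inord 2))).
  have [x3 c3] := inV _ (labV (f (inord 3))).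
  have [b bT uniq_b] := common_neighbor x2 x3 c2 c3 (labneq 2%N 3%N isT isT isT) T23.
  have common u : (u < 2)%N -> lab (f (inord u)) = (x |` T) `\ b.
    move=> u2; have [xu cu] := inV _ (labV (f (inord u))).
    have [U2 adj2] : exists T,
        adjacent_faces x (lab (f (inord u))) (lab (f (inord 2))) T.
      by apply: fadj; lia.
    have [U3 adj3] : exists T,
        adjacent_faces x (lab (f (inord u))) (lab (f (inord 3))) T.
      by apply: fadj; lia.
    by apply: uniq_b adj2 adj3 => //; apply: labneq; lia.
  by have := labneq 0%N 1%N isT isT isT; rewrite !common ?eqxx.
have Egraph : simple_graph E.
  by apply/forall_inP => A; rewrite inE => /andP[].
apply: leq_trans (@leq_bigmax_cond _ _ _ E _); last by rewrite Egraph Ekite.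
have tri_face (T : {fset R * R}) (c : R * R) : T \in empty_but x P -> c \in T ->
    exists2 i, lab i = (x |` T) `\ c & i \in tri T.
  move=> TB cT; have [i labi] := lab_surj _ (face_empty_triangle xP TB cT).
  by exists i => //; rewrite inE labi fsubD1set.
have tri_inj : {in empty_but x P &, injective tri}.
  move=> T U TB UB eqTU; have [T3 xT _] := empty_but_stabbed TB.
  have [U3 _ _] := empty_but_stabbed UB.
  apply: fsubset_card_eq; last by rewrite T3.
  apply/fsubsetP => d dT.
  have [a [b [ad _ _ TE]]] := cardfs3P T3 dT.
  have aT : a \in T by rewrite TE !inE eqxx orbT.
  have [i labi] := tri_face T a TB aT; rewrite eqTU inE => /fsubsetP/(_ d).
  rewrite labi !inE dT orbT eq_sym ad => /(_ isT) /orP[/eqP dx|//].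
  by rewrite dx (negPf xT) in dT.
have tri3 (T : {fset R * R}) : T \in empty_but x P -> #|tri T| = 3%N.
  move=> TB; have sT := empty_but_stabbed TB; have [T3 xT _] := sT.
  have /fset0Pn[a aT] : T != fset0 by rewrite -cardfs_gt0 T3.
  have [b [c [ba ca bc TE]]] := cardfs3P T3 aT.
  have bT : b \in T by rewrite TE !inE eqxx orbT.
  have cT : c \in T by rewrite TE !inE eqxx orbT.
  have [i labi iT] := tri_face T a TB aT.
  have [j labj jT] := tri_face T b TB bT.
  have [k labk kT] := tri_face T c TB cT.
  have neq_face p q : p \in T -> q != p -> (x |` T) `\ p != (x |` T) `\ q.
    move=> pT qp; apply/eqP => /fsetP/(_ p).
    by rewrite !inE eqxx pT orbT eq_sym qp.
  have ij : i != j by rewrite -(inj_eq lab_inj) labi labj neq_face.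
  have ik : i != k by rewrite -(inj_eq lab_inj) labi labk neq_face.
  have jk : j != k by rewrite -(inj_eq lab_inj) labj labk neq_face // eq_sym.
  have -> : tri T = [set i; j; k].
    apply/setP => l; apply/idP/idP; last by rewrite !inE -orbA => /or3P[]/eqP->;
      [move: iT|move: jT|move: kT]; rewrite inE.
    rewrite inE => lT; have [xl l3] := inV _ (labV l).
    (* A three-element set containing [x] cannot contain [T], so [lab l] omits a vertex of [T] and
       is one of the three faces. *)
    have : ~~ (T `<=` lab l).
      apply/negP => Tl; have : x |` T `<=` lab l by rewrite fsubUset fsub1set xl.
      by move=> /fsubset_leq_card; rewrite stabbed_card4 // l3.
    case/fsubsetPn => d dT dl.
    have labl : lab l = (x |` T) `\ d.
      by apply: stabbed_face => //; rewrite !inE dT orbT.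
    move: dT labl; rewrite {1}TE !inE -orbA -!(inj_eq lab_inj) labi labj labk.
    by move=> /or3P[]/eqP-> ->; rewrite eqxx ?orbT.
  by rewrite finset.setUC cardsU1 cards2 !inE negb_or ij !(eq_sym k) ik jk.
have triV_inj : injective (fun T : empty_but x P => tri (val T)).
  by move=> T U eqTU; apply/val_inj/tri_inj => //; exact: valP.
rewrite cardfE -cardsT -(card_imset _ triV_inj); apply: subset_leq_card.
apply/fintype.subsetP => A /imsetP[T _ ->]; rewrite inE tri3 ?(valP T) //=.
apply/forallP => A'; apply/implyP => /andP[A'T /eqP A'2].
exact: triE (valP T) A'T A'2.
Qed.

Lemma Delta_le (R : realType) (P : {fset R * R}) (x : R * R) :
  x \in P ->
  (Delta x P <= num_empty_triangles_at P x
                + H_K3_kite (num_empty_triangles_at P x))%N.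
Proof.
move=> xP; have [k [NP NPx]] := card_empty_triangles xP.
by have := card_empty_but_le xP; rewrite /Delta NP NPx; lia.
Qed.

(** * Points on a parabola *)

Definition parabola_point (R : realType) (t : R) : R * R := (t, t ^+ 2).

Definition parabola_points (R : realType) (S : {fset R}) : {fset R * R} :=
  [fset parabola_point t | t in S].

Lemma parabola_pointsP (R : realType) (S : {fset R}) (p : R * R) :
  reflect (exists2 t, t \in S & p = parabola_point t) (p \in parabola_points S).
Proof. exact: imfsetP. Qed.

Lemma parabola_point_inj (R : realType) : injective (@parabola_point R).
Proof. by move=> s t []. Qed.

Lemma parabola_point_in (R : realType) (S : {fset R}) (t : R) :
  (parabola_point t \in parabola_points S) = (t \in S).
Proof.
by apply/parabola_pointsP/idP => [[s sS /parabola_point_inj->]//|tS]; exists t.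
Qed.

Lemma apex_notin_parabola (R : realType) (S : {fset R}) (h : R) :
  0 \notin S -> (0, h) \notin parabola_points S.
Proof. by move=> S0; apply/parabola_pointsP => -[t tS [t0 _]]; rewrite t0 tS in S0. Qed.

(** This is the Vandermonde determinant. *)
Lemma orient_parabola (R : realType) (s t u : R) :
  orient (parabola_point s) (parabola_point t) (parabola_point u) =
  (t - s) * (u - s) * (u - t).
Proof. by rewrite /orient /=; ring. Qed.

(** The chord meets the vertical axis at height [- (s * t)], so [s * t + h] is the height of the
    apex above it. *)
Lemma orient_apex (R : realType) (h s t : R) :
  orient (0, h) (parabola_point s) (parabola_point t) = (t - s) * (s * t + h).
Proof. by rewrite /orient /=; ring. Qed.

Lemma orient_rot (R : realType) (p q r : R * R) : orient p q r = orient q r p.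
Proof. by rewrite /orient; ring. Qed.

Lemma apex_general_position (R : realType) (S : {fset R}) (h : R) :
  {in S &, forall s t, s * t + h != 0} ->
  general_position ((0, h) |` parabola_points S).
Proof.
move=> sth p q r pP qP rP pq qr pr /collinear3_orient.
have apex s t : s \in S -> t \in S -> parabola_point s <> parabola_point t ->
    orient (0, h) (parabola_point s) (parabola_point t) != 0.
  move=> sS tS st; rewrite orient_apex mulf_neq0 ?sth // subr_eq0.
  by apply: contra_notN st => /eqP->.
move: pP qP rP pq qr pr; rewrite !inE => /orP[/eqP->|/parabola_pointsP[s sS ->]].
  move=> /orP[/eqP->//|/parabola_pointsP[t tS ->]].
  move=> /orP[/eqP->//|/parabola_pointsP[u uS ->]] _ tu _.
  by apply/eqP/apex.
move=> /orP[/eqP->|/parabola_pointsP[t tS ->]].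
  move=> /orP[/eqP->//|/parabola_pointsP[u uS ->]] _ _ su.
  by rewrite orient_rot; apply/eqP/apex => // us; apply: su.
move=> /orP[/eqP->|/parabola_pointsP[u uS ->]] st tu su.
  by rewrite -orient_rot; apply/eqP/apex.
rewrite orient_parabola => /eqP; rewrite !mulf_eq0 !subr_eq0 -orbA.
by move=> /or3P[]/eqP eqst; [apply: st|apply: su|apply: tu]; rewrite eqst.
Qed.

(** The tangent at parameter [s] supports the parabola: the form with coefficients [2 * s] and [-1]
    is maximal there. *)
Lemma parabola_point_notin_interior (R : realType) (S : {fset R}) (T : {fset R * R})
    (s : R) :
  T `<=` parabola_points S -> ~ interior (convex_hull T) (parabola_point s).
Proof.
move=> TS /(@interior_hull_gt _ _ _ (2 * s) (-1))[].
  by move=> [_ /eqP]; rewrite oppr_eq0 oner_eq0.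
move=> _ /(fsubsetP TS)/parabola_pointsP[t _ ->] /= lt_st.
by have := sqr_ge0 (t - s); rewrite leNgt => /negP; apply; nra.
Qed.

(** The apex is above the two short chords and below the long one. *)
Lemma apex_in_interior (R : realType) (h s t u : R) :
  s < t -> t < u -> 0 < s * t + h -> 0 < t * u + h -> s * u + h < 0 ->
  interior (convex_hull
    [fset parabola_point s; parabola_point t; parabola_point u]) (0, h).
Proof.
move=> st tu sth tuh suh; apply: orient_interior.
- by rewrite orient_apex mulr_gt0 // subr_gt0.
- rewrite orient_rot orient_apex mulrC nmulr_rgt0 ?subr_lt0 1?mulrC //.
  exact: lt_trans tu.
- by rewrite -orient_rot orient_apex mulr_gt0 // subr_gt0.
Qed.

(** * The three-cluster configuration and its counts *)

Lemma num_empty_triangles_at_le (R : realType) (P : {fset R * R}) (x : R * R) :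
  (num_empty_triangles_at P x <= #|` P `\ x| ^ 2)%N.
Proof.
rewrite /num_empty_triangles_at; set V := [fset T in _ | _].
rewrite -mulnn -(size_allpairs (fun a b => [fset x; a; b])).
apply: uniq_leq_size (fset_uniq V) _ => T.
rewrite in_fset_sep => /andP[/empty_trianglesP[TP T3 _] xT].
have [a [b [ax bx _ TE]]] := cardfs3P T3 xT.
apply/allpairsP; exists (a, b); split => //=.
  by rewrite !inE ax (fsubsetP TP) // TE !inE eqxx orbT.
by rewrite !inE bx (fsubsetP TP) // TE !inE eqxx orbT.
Qed.

(* The apex [(0, h)] lies above the chord joining the points of parameters
   [s < 0 < t] iff [- (s * t) < h].  When [3 * k <= m], [- (s * t)] is at most
   [5 * m ^ 2] for [t] in the middle cluster and at least [16 * m ^ 2] for [t] in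
   the far one, hence the choice [h = 6 * m ^ 2] below.  For [k = 0] there are no
   negative parameters. *)
Definition param (R : realType) (k m i : nat) : R :=
  if (i < k)%N then - (4 * m + i)%:R else
  if (i < 2 * k)%N then (4 * m + i)%:R else i.+1%:R.

Definition params (R : realType) (k m : nat) : {fset R} :=
  [fset param R k m i | i in iota 0 m].

Lemma paramsP (R : realType) (k m : nat) (t : R) :
  reflect (exists2 i, (i < m)%N & t = param R k m i) (t \in params R k m).
Proof.
apply: (iffP (imfsetP _ _ _ _)) => -[i im ->]; exists i => //; move: im.
  by rewrite /= mem_iota.
by rewrite /= mem_iota.
Qed.

Lemma param_inj (R : realType) (k m i j : nat) : (i < m)%N -> (j < m)%N ->
  param R k m i = param R k m j -> i = j.
Proof.
move=> im jm; rewrite /param.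
have neg (a b : nat) : (0 < b)%N -> - a%:R != b%:R :> R.
  move=> b0; rewrite lt_eqF // (le_lt_trans (y := 0)) ?oppr_le0 ?ler0n //.
  by rewrite ltr0n.
have neg' (a b : nat) : (0 < b)%N -> b%:R != - a%:R :> R.
  by move=> b0; rewrite eq_sym neg.
case: (ltnP i k) => ik; case: (ltnP j k) => jk.
- by move=> /oppr_inj/eqP; rewrite eqr_nat => /eqP; lia.
- by case: ifP => _ /eqP; rewrite (negPf (neg _ _ _)) //; lia.
- by case: ifP => _ /eqP; rewrite (negPf (neg' _ _ _)) //; lia.
- by case: ltnP => i2k; case: ltnP => j2k /eqP; rewrite eqr_nat => /eqP; lia.
Qed.

Lemma card_params (R : realType) (k m : nat) : #|` params R k m| = m.
Proof.
rewrite card_in_imfset /= => [|i j]; first by rewrite undup_id ?iota_uniq ?size_iota.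
by rewrite !mem_iota /= => im jm /param_inj; apply.
Qed.

Definition apex (R : realType) (m : nat) : R * R := (0, (6 * m ^ 2)%:R).

Definition apex_set (R : realType) (k m : nat) : {fset R * R} :=
  apex R m |` parabola_points (params R k m).

Lemma params_neq0 (R : realType) (k m : nat) : 0 \notin params R k m.
Proof.
apply/paramsP => -[i im] /eqP; rewrite eq_sym /param.
case: ltnP => ik; first by rewrite oppr_eq0 pnatr_eq0; lia.
by case: ltnP => _; rewrite pnatr_eq0; lia.
Qed.

(** Parameters of opposite signs have a product of absolute value below [5 * m ^ 2] or at least
    [16 * m ^ 2]; those of equal sign give a positive sum. *)
Lemma params_apex_neq0 (R : realType) (k m : nat) :
  {in params R k m &, forall s t, s * t + (6 * m ^ 2)%:R != 0}.
Proof.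
move=> _ _ /paramsP[i im ->] /paramsP[j jm ->]; rewrite /param.
by repeat case: ltnP => ?; rewrite ?mulrNN ?mulNr ?mulrN -natrM -?natrD ?pnatr_eq0;
  rewrite 1?addrC ?subr_eq0 ?eqr_nat; nia.
Qed.

Lemma apexD1 (R : realType) (k m : nat) :
  apex_set R k m `\ apex R m = parabola_points (params R k m).
Proof. by rewrite fsetU1K // apex_notin_parabola // params_neq0. Qed.

Lemma card_apexD1 (R : realType) (k m : nat) :
  #|` apex_set R k m `\ apex R m| = m.
Proof. by rewrite apexD1 card_imfset ?card_params //; exact: parabola_point_inj. Qed.

Lemma empty_but_apex (R : realType) (k m : nat) (T : {fset R * R}) :
  T `<=` parabola_points (params R k m) -> #|` T| = 3%N ->
  interior (convex_hull T) (apex R m) ->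
  T \in empty_but (apex R m) (apex_set R k m).
Proof.
move=> TP T3 Tx; rewrite in_fset_sep; apply/andP; split; last exact/asboolP.
apply/empty_trianglesP; rewrite apexD1; split=> // p /parabola_pointsP[s _ ->].
exact: parabola_point_notin_interior TP.
Qed.

Lemma card_empty_but_ge (R : realType) (k m : nat) : (3 * k <= m)%N ->
  (k ^ 3 <= #|` empty_but (apex R m) (apex_set R k m)|)%N.
Proof.
move=> km; pose pt i := parabola_point (param R k m i).
(* The vertices are listed by increasing parameter: negative, middle, far. The hypothesis
   [3 * k <= m] keeps the index [2 * k + z.2] below [m]. *)
pose tri (z : 'I_k * 'I_k * 'I_k) : {fset R * R} :=
  [fset pt z.1.1; pt (2 * k + z.2)%N; pt (k + z.1.2)%N].
have pt_inj i j : (i < m)%N -> (j < m)%N -> (pt i == pt j) = (i == j).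
  move=> im jm; apply/eqP/eqP => [/parabola_point_inj/param_inj|->//].
  exact.
have tri_inj : injective tri.
  move=> [[a b] c] [[a' b'] c'] /fsetP eq_tri.
  have := eq_tri (pt a); have := eq_tri (pt (k + b)%N).
  have := eq_tri (pt (2 * k + c)%N); rewrite !inE /= !eqxx !orbT /=.
  have := ltn_ord a; have := ltn_ord b; have := ltn_ord c.
  have := ltn_ord a'; have := ltn_ord b'; have := ltn_ord c'.
  move=> c'k b'k a'k ck bk ak; rewrite !pt_inj; try lia.
  by move=> ? ? ?; congr (_, _, _); apply/val_inj => /=; lia.
have -> : (k ^ 3)%N = size [seq tri z | z <- enum {: 'I_k * 'I_k * 'I_k}].
  by rewrite size_map -cardE !card_prod !card_ord; lia.
apply: uniq_leq_size; first by rewrite map_inj_uniq ?enum_uniq.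
move=> _ /mapP[[[a b] c] _ ->]; rewrite /tri /=.
have := ltn_ord a; have := ltn_ord b; have := ltn_ord c.
move: (nat_of_ord a) (nat_of_ord b) (nat_of_ord c) => {a b c} a b c ck bk ak.
have pt_in i : (i < m)%N -> pt i \in parabola_points (params R k m).
  by move=> im; rewrite parabola_point_in; apply/paramsP; exists i.
apply: empty_but_apex.
- by rewrite !fsubUset !fsub1set !pt_in //; lia.
- by rewrite cardfs3 // pt_inj; lia.
have pa : param R k m a = - (4 * m + a)%:R by rewrite /param ak.
have pb : param R k m (k + b) = (4 * m + (k + b))%:R.
  by rewrite /param ltnNge leq_addr /= (_ : (k + b < 2 * k)%N) //; lia.
have pc : param R k m (2 * k + c) = (2 * k + c).+1%:R.
  rewrite /param ltnNge (_ : (k <= 2 * k + c)%N); last by lia.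
  by rewrite /= ltnNge leq_addr.
apply: apex_in_interior; rewrite ?pa ?pb ?pc.
- by rewrite (le_lt_trans (y := 0)) ?oppr_le0 ?ler0n ?ltr0n.
- by rewrite ltr_nat; lia.
- by rewrite mulNr -natrM addrC subr_gt0 ltr_nat; nia.
- by rewrite -natrM -natrD ltr0n; nia.
- by rewrite mulNr -natrM addrC subr_lt0 ltr_nat; nia.
Qed.

(** All parameters are positive here, so no vertex lies to the left of the apex. *)
Lemma card_empty_but0 (R : realType) (m : nat) :
  #|` empty_but (apex R m) (apex_set R 0 m)| = 0%N.
Proof.
apply/eqP; rewrite cardfs_eq0; apply/eqP/fsetP => T; rewrite in_fset0.
apply/negP; rewrite in_fset_sep => /andP[/empty_trianglesP[]]; rewrite apexD1.
move=> TP _ _ /asboolP /(@interior_hull_gt _ _ _ (-1) 0)[].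
  by move=> [/eqP]; rewrite oppr_eq0 oner_eq0.
move=> _ /(fsubsetP TP)/parabola_pointsP[_ /paramsP[i im ->] ->] /=.
rewrite /param /= !mul0r mulr0 !addr0 mulN1r oppr_gt0.
by rewrite ltNge ler0n.
Qed.

Lemma powR_three_halves_le (R : realType) (v m : nat) : (v <= m ^ 2)%N ->
  powR v%:R (3%:R / 2%:R) <= (v * m)%:R :> R.
Proof.
move=> vm; have [->|v0] := eqVneq v 0%N; first by rewrite powR0 ?mul0n //; lra.
(* The power is [v] times its square root, and that root is at most [m]. *)
have -> : 3%:R / 2%:R = 1 + 2^-1 :> R by field.
rewrite powRD; last by rewrite pnatr_eq0 v0 implybT.
rewrite powRr1 ?ler0n // powR12_sqrt ?ler0n // natrM ler_wpM2l ?ler0n //.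
rewrite -[leRHS]ger0_norm ?ler0n // -sqrtr_sqr ler_sqrt ?exprn_ge0 ?ler0n //.
by rewrite -natrX ler_nat.
Qed.

Theorem theorem1 (R : realType) :
  (forall (n : nat) (P : {fset R * R}) (x : R * R),
      #|` P|%fset = n -> general_position P -> x \in P ->
      (Delta x P <= num_empty_triangles_at P x
                    + H_K3_kite (num_empty_triangles_at P x))%N)
  /\
  (exists C : R, 0 < C /\
    forall n : nat, (0 < n)%N ->
      exists (P : {fset R * R}) (x : R * R),
        [/\ #|` P|%fset = n, general_position P, x \in P &
            C * powR (num_empty_triangles_at P x)%:R (3%:R / 2%:R)
              <= (Delta x P)%:R]).
Proof.
split=> [n P x _ _|]; first exact: Delta_le.
(* The goal becomes [v * m <= 128 * Delta]. For [m < 60], [Delta = v]. Otherwise [k >= 20] gives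
   [v <= 10 * k ^ 2], at most half of [k ^ 3], so [Delta] is at least half of [k ^ 3], while
   [v * m <= 40 * k ^ 3]; a factor 80 would do. *)
exists 128%:R^-1; split; first by rewrite invr_gt0 ltr0n.
(* The apex accounts for one of the [n = m.+1] points. *)
case=> // m _; pose k := if (m < 60)%N then 0%N else (m %/ 3)%N.
have xP : apex R m \in apex_set R k m by rewrite !inE eqxx.
exists (apex_set R k m), (apex R m); split=> //.
- by rewrite (cardfsD1 (apex R m)) xP card_apexD1.
- exact/apex_general_position/params_apex_neq0.
have := num_empty_triangles_at_le (apex_set R k m) (apex R m).
rewrite card_apexD1; have [K [NP NPx]] := card_empty_triangles xP.
rewrite /Delta NP NPx; move: (num_empty_triangles_at _ _) => v vm.
rewrite ler_pdivrMl ?ltr0n // -natrM; apply: le_trans (powR_three_halves_le R vm) _.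
rewrite ler_nat; have [m60|m60] := ltnP m 60.
  by rewrite /k m60 card_empty_but0; nia.
have kE : k = (m %/ 3)%N by rewrite /k ifN // -leqNgt.
have B_ge : (k ^ 3 <= #|` empty_but (apex R m) (apex_set R k m)|)%N.
  by apply: card_empty_but_ge; rewrite kE; lia.
have m_le : (m <= 3 * k + 2)%N by rewrite kE; lia.
have k_ge : (20 <= k)%N by rewrite kE; lia.
have m2_le : (m ^ 2 <= 10 * k ^ 2)%N.
  by apply: (@leq_trans ((3 * k + 2) ^ 2)); [rewrite leq_exp2r|nia].
have k3_ge : (20 * k ^ 2 <= k ^ 3)%N by rewrite (expnS k 2) leq_mul2r k_ge orbT.
have m3_le : (v * m <= m ^ 2 * (4 * k))%N by apply: leq_mul => //; lia.
have k3_le : (m ^ 2 * (4 * k) <= 10 * k ^ 2 * (4 * k))%N.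
  by rewrite leq_mul2r m2_le orbT.
have k3E : (10 * k ^ 2 * (4 * k) = 40 * k ^ 3)%N by rewrite (expnS k 2); lia.
by lia.
Qed.
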